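(* Let $\alpha\in(0,1)$ and let $\mathcal M\subseteq\mathcal M_0$. Let $m\colon\mathcal M\to\mathbb R$ be an identifiable functional with a strict $\mathcal M$-identification function $V_m\colon\mathbb R\times\mathbb R\to\mathbb R$. Set $b\colon\mathcal M\to[0,\infty)$, $b(F)=d_\alpha(F)(m(F))$ (half the length of the shortest $\alpha$-prediction interval with midpoint $m(F)$), and $T_m=(m,b)^\top\colon\mathcal M\to\mathbb R\times[0,\infty)$. Then: (i) $T_m$ is identifiable on $\mathcal M\cap\mathcal M_{\mathrm{inc,cont}}$ with strict identification function $V\colon\mathbb R\times[0,\infty)\times\mathbb R\to\mathbb R^2$, $$V(z_1,z_2,y)=\big(V_m(z_1,y),\ \mathbf 1\{y\in[z_1-z_2,z_1+z_2]\}-\alpha\big)^\top.$$ (ii) Assume that $\mathcal M$ is such that (a) $\mathcal M\cap\mathcal M_{\mathrm{inc,cont}}$ is convex; (b) for any $z\in\mathbb R\times(0,\infty)$ there are $F_1,F_2,F_3\in\mathcal M\cap\mathcal M_{\mathrm{inc,cont}}$ such that $0$ is in the interior of the convex hull of $\{\bar V(z,F_i):i\in\{1,2,3\}\}\subset\mathbb R^2$; (c) $\bar V(\cdot,F)$ is continuously differentiable on $\mathbb R\times(0,\infty)$ for all $F\in\mathcal M\cap\mathcal M_{\mathrm{inc,cont}}$; (d) for any $(m^*,b^* )^\top\in\mathbb R\times(0,\infty)$ there are $F_i\in\mathcal M\cap\mathcal M_{\mathrm{inc,cont}}$ with densities $f_i$, $i\in\{1,2,3,4\}$, such that $(m(F_i),b(F_i))^\top=(m^*,b^*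 )^\top$ for $i=1,2,3,4$; $\bar V_m'(m^*,F_1)=\bar V_m'(m^*,F_2)=\bar V_m'(m^*,F_3)$; $f_1(m^*+b^* )+f_1(m^*-b^* )=f_2(m^*+b^* )+f_2(m^*-b^* )$; $f_1(m^*+b^* )+f_1(m^*-b^* )\ne f_3(m^*+b^* )+f_3(m^*-b^* )$; $f_1(m^*+b^* )-f_1(m^*-b^* )\ne f_2(m^*+b^* )-f_2(m^*-b^* )$; and $\bar V_m'(m^*,F_4)\ne0$. Then there is no strictly $\mathcal M\cap\mathcal M_{\mathrm{inc,cont}}$-consistent scoring function $S$ for $T_m$ such that $\bar S(\cdot,F)$ is twice continuously differentiable on $\mathbb R\times(0,\infty)$ for every $F\in\mathcal M\cap\mathcal M_{\mathrm{inc,cont}}$.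
   Context: $\mathcal M_0$ is the class of Borel probability distributions on $\mathbb R$ (identified with their distribution functions); $\mathcal M_{\mathrm{inc,cont}}$ is the subclass of continuous distribution functions that are strictly increasing on $\mathbb R$. For $F\in\mathcal M_0$ and $c_0\in\mathbb R$, $d_\alpha(F)(c_0)=\inf\{c\ge0:F([c_0-c,c_0+c])\ge\alpha\}$. For a function $V$, $\bar V(x,F)=\int V(x,y)\,dF(y)$ (assumed to exist and be finite); $\bar V_m'(x,F)$ is the derivative of $\bar V_m(\cdot,F)$ at $x$. $V$ is a strict $\mathcal M'$-identification function for a functional $T\colon\mathcal M'\to\mathsf A$ if for all $x\in\mathsf A$, $F\in\mathcal M'$: $\bar V(x,F)=0$ iff $x=T(F)$; $T$ is identifiable if such a $V$ exists. A scoring function for $T_m$ is a map $S\colon(\mathbb R\times[0,\infty))\times\mathbb R\to(-\infty,\infty]$ with $\bar S(x,F)=\int S(x,y)\,dF(y)$ existing and $\bar S(x,F)<\infty$ for all $x$ and all $F$ in the class considered; it is strictly $\mathcal M'$-consistent for $T$ if $\bar S(T(F),F)\le\bar S(x,F)$ for all $x$ and $F\in\mathcal M'$, with equality only if $x=T(F)$. *)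

(* Defs.v *)
From HB Require Import structures.
From mathcomp Require Import all_boot all_order all_algebra.
From mathcomp Require Import all_classical all_reals all_analysis.
From mathcomp Require Import measurable_realfun.

Set Implicit Arguments.
Unset Strict Implicit.
Unset Printing Implicit Defensive.
Import Order.TTheory GRing.Theory Num.Theory.
Import numFieldNormedType.Exports.
Local Open Scope classical_set_scope.
Local Open Scope ring_scope.

(* A class of distributions is a [set (distr R)] and a functional on it is a
   total function on [distr R] of which only the values on the class matter.
   Since a measure is a function on all sets, two elements of [distr R] may
   agree on the Borel sets without being Leibniz-equal; nothing below tells
   such representatives of one Borel distribution apart (see [convex_class]). *)
Definition distr (R : realType) := probability (measurableTypeR R) R.

Section Distributions.
Context {R : realType}.
Implicit Types (F G H : distr R) (M : set (distr R)).

Definition dfun F (x : R) : R := fine (F `]-oo, x]%classic).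

Definition inc_cont : set (distr R) :=
  [set F | continuous (dfun F) /\ {homo dfun F : x y / x < y}].

Definition d_ (alpha : R) F (c0 : R) : R :=
  inf [set c | 0 <= c /\ (alpha%:E <= F `[(c0 - c)%R, (c0 + c)%R]%classic)%E].

(* Some representative of each mixture lies in M. *)
Definition convex_class M : Prop :=
  forall F G (t : R), M F -> M G -> 0 <= t <= 1 ->
  exists2 H, M H & forall B, measurable B ->
    H B = (t%:E * F B + (1 - t)%:E * G B)%E.

(* A density is only determined almost everywhere, so statements about its
   value at a given point need a choice of version.  The last clause fixes it
   at every point where the distribution function is differentiable.  It does
   not restrict F: by Lebesgue's differentiation theorem any density can be
   modified on a null set so as to satisfy it. *)
Definition is_density F (f : R -> R) : Prop :=
  [/\ measurable_fun setT f,
      forall x, 0 <= f x,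
      forall B, measurable B ->
        F B = (\int[lebesgue_measure]_(x in B) (f x)%:E)%E
    & forall x, derivable (dfun F) x 1 -> f x = (dfun F)^`()%classic x].

End Distributions.


Section Identification.
Context {R : realType}.
Implicit Types (F : distr R) (M : set (distr R)).

Definition barV (V : R -> R -> R) (x : R) F : R := \int[F]_y V x y.

Definition strict_identification M (T : distr R -> R) (V : R -> R -> R) : Prop :=
  forall x F, M F ->
    F.-integrable setT (EFin \o V x) /\ (barV V x F = 0 <-> x = T F).

Definition barV2 (V : R * R -> R -> R * R) (z : R * R) F : R * R :=
  (\int[F]_y (V z y).1, \int[F]_y (V z y).2).

Definition strict_identification2 (A : set (R * R)) M (T : distr R -> R * R)
    (V : R * R -> R -> R * R) : Prop :=
  (forall F, M F -> A (T F)) /\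
  forall z F, A z -> M F ->
    [/\ F.-integrable setT (fun y => (V z y).1%:E),
        F.-integrable setT (fun y => (V z y).2%:E)
      & barV2 V z F = 0 <-> z = T F].

Definition action_domain : set (R * R) := [set z | 0 <= z.2].
Definition open_domain : set (R * R) := [set z | 0 < z.2].

Definition pred_halflength (alpha : R) (m : distr R -> R) F : R :=
  d_ alpha F (m F).

Definition pred_functional (alpha : R) (m : distr R -> R) F : R * R :=
  (m F, pred_halflength alpha m F).

Definition pred_identification (alpha : R) (Vm : R -> R -> R)
    (z : R * R) (y : R) : R * R :=
  (Vm z.1 y, \1_(`[z.1 - z.2, z.1 + z.2]%classic) y - alpha).

End Identification.

Section Scoring.
Context {R : realType}.
Implicit Types (F : distr R) (M : set (distr R)).

(* The integral exists in [-oo, +oo]; without this the library's integral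
   still has a value. *)
Definition integral_exists F (f : R -> \bar R) : Prop :=
  measurable_fun setT f /\
  ((\int[F]_y (f^\+ y) < +oo)%E \/ (\int[F]_y (f^\- y) < +oo)%E).

Definition barS (S : R * R -> R -> \bar R) (z : R * R) F : \bar R :=
  (\int[F]_y S z y)%E.

Definition scoring_function (A : set (R * R)) M (S : R * R -> R -> \bar R) :
    Prop :=
  (forall z y, A z -> (-oo < S z y)%E) /\
  (forall z F, A z -> M F -> integral_exists F (S z) /\ (barS S z F < +oo)%E).

Definition strictly_consistent (A : set (R * R)) M (T : distr R -> R * R)
    (S : R * R -> R -> \bar R) : Prop :=
  forall z F, A z -> M F ->
    (barS S (T F) F <= barS S z F)%E /\
    (barS S (T F) F = barS S z F -> z = T F).

End Scoring.

Section Calculus.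
Context {R : realType}.

Definition convex_hull (A : set (R * R)) : set (R * R) :=
  \bigcap_(C in [set C : set (R * R) |
                 convex_set (C : set (convex_lmodType (R * R)%type)) /\
                 A `<=` C]) C.

(* U is meant to be open.  On the finite-dimensional R * R, continuity of all
   directional derivatives is continuity of the differential. *)
Definition C1_on (W : normedModType R) (U : set (R * R)) (f : R * R -> W) :
    Prop :=
  forall z, U z ->
    differentiable f z /\ forall v, {for z, continuous ('D_v f)}.

Definition C2_on (W : normedModType R) (U : set (R * R)) (f : R * R -> W) :
    Prop :=
  C1_on U f /\ forall v, C1_on U ('D_v f).

End Calculus.

(* Main.v *)
Require Import Defs.
From mathcomp Require Import all_boot all_order all_algebra.
From mathcomp Require Import all_classical all_reals all_analysis.
From mathcomp Require Import measurable_realfun.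
From mathcomp Require Import ring lra.
Import Order.TTheory GRing.Theory Num.Theory.
Import numFieldNormedType.Exports.
Local Open Scope classical_set_scope.
Local Open Scope ring_scope.

Set Implicit Arguments.
Unset Strict Implicit.
Unset Printing Implicit Defensive.

(* Osband's principle: for fixed z, the expected identification function
   V(z, F) and the gradient of S(., F) at z are affine in F, and the gradient
   vanishes whenever V(z, F) = 0, because z is then the minimiser of S(., F).
   As 0 is interior to the set of values of V(z, .), the gradient is a linear
   image h(z) V(z, F) with h(z) not depending on F.  Differentiating at
   z = T(F), the Hessian is h(z) DV(z, F).  Its symmetry reads
     h12 (f(z1 + z2) + f(z1 - z2)) = h21 Vm' + h22 (f(z1 + z2) - f(z1 - z2)),
   and the distributions F1, ..., F4 of (d) force h12 = h21 = h22 = 0.  Hence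
   S(., F) does not depend on z2, which contradicts strict consistency. *)

(** * Integrals against mixtures of distributions *)

(** The integral is the difference of the integrals of the positive and the negative part. Existence
    makes one of them finite, and finiteness of the difference then bounds the other. *)
Lemma integrable_of_finite (R : realType) (F : distr R) (f : R -> \bar R) :
  integral_exists F f -> (\int[F]_y f y)%E \is a fin_num ->
  F.-integrable setT f.
Proof.
move=> [mf fin]; rewrite integralE => ffin; apply/integrableP; split=> //.
have [pos neg] : (\int[F]_y f^\+ y < +oo)%E /\ (\int[F]_y f^\- y < +oo)%E.
  have p0 : (0 <= \int[F]_y f^\+ y)%E by apply: integral_ge0.
  have n0 : (0 <= \int[F]_y f^\- y)%E by apply: integral_ge0.
  move: p0 n0 fin ffin; case: (\int[F]_y f^\+ y)%E => [a| |];
    case: (\int[F]_y f^\- y)%E => [b| |]//=; rewrite ?ltry//= => _ _ [].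
rewrite (_ : integral _ _ _ = \int[F]_y (f^\+ y + f^\- y))%E; last first.
  by congr integral; rewrite -[RHS]fune_abse.
rewrite ge0_integralD//=; first exact: lte_add_pinfty.
- exact: measurable_funepos.
- exact: measurable_funeneg.
Qed.

(** On Borel sets [H] is a sum of two scaled measures, which suffices for integrals. Additivity in
    the measure is used for the positive and the negative part separately; integrability makes the
    four resulting integrals real, so that they can be regrouped. *)
Lemma integral_mixture (R : realType) (F G H : distr R) (t : R)
    (f : R -> \bar R) : 0 <= t <= 1 ->
  (forall B, measurable B -> H B = (t%:E * F B + (1 - t)%:E * G B)%E) ->
  F.-integrable setT f -> G.-integrable setT f ->
  (\int[H]_y f y = t%:E * \int[F]_y f y + (1 - t)%:E * \int[G]_y f y)%E.
Proof.
move=> /andP[t0 t1] HFG Ff Gf.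
have mf : measurable_fun setT f by case/integrableP: Ff.
have t1' : 0 <= 1 - t by rewrite subr_ge0.
pose m1 := mscale (NngNum t0) F; pose m2 := mscale (NngNum t1') G.
have HE (g : R -> \bar R) :
    (\int[H]_y g y = \int[measure_add m1 m2]_y g y)%E.
  apply: eq_measure_integral => B mB _.
  by rewrite [RHS]measure_addE; exact: HFG.
have mix g : measurable_fun setT g -> (forall x, 0 <= g x)%E ->
  (\int[H]_y g y = t%:E * \int[F]_y g y + (1 - t)%:E * \int[G]_y g y)%E.
  move=> mg g0.
  by rewrite HE ge0_integral_measure_add// !ge0_integral_mscale.
have mfp := measurable_funepos mf; have mfn := measurable_funeneg mf.
rewrite integralE mix// mix//= [in RHS]integralE.
rewrite [in X in (_ = _ + X)%E]integralE.
have := integrable_fin_num measurableT (integrable_funepos measurableT Ff).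
have := integrable_fin_num measurableT (integrable_funepos measurableT Gf).
have := integrable_fin_num measurableT (integrable_funeneg measurableT Ff).
have := integrable_fin_num measurableT (integrable_funeneg measurableT Gf).
do 4 move=> /fineK <-.
move: (fine _) (fine _) (fine _) (fine _) => a b c d.
rewrite -?EFinB -?EFinM -?EFinD -?EFinB.
congr (_%:E); ring.
Qed.

(** * Symmetry of second directional derivatives *)

Section Schwarz.
Context {R : realType} {V : normedModType R}.
Implicit Types (f : V -> R) (x u v : V).

Lemma is_derive_line f x v (a : R) : derivable f (x + a *: v) v ->
  is_derive a 1 (fun h => f (x + h *: v)) ('D_v f (x + a *: v)).
Proof.
have E : (fun h => h^-1 *: (((fun h => f (x + h *: v)) \o shift a) (h *: 1) -
    f (x + a *: v))) =
  (fun h => h^-1 *: ((f \o shift (x + a *: v)) (h *: v) - f (x + a *: v))).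
  by apply/funext => h /=; rewrite [h *: 1]mulr1 scalerDl addrCA.
move=> df; apply: DeriveDef; first by rewrite /derivable /= E.
by rewrite /derive /= E.
Qed.

Lemma MVT_line f x v (t : R) : 0 < t ->
  (forall a, 0 <= a <= t -> derivable f (x + a *: v) v) ->
  exists2 a, 0 < a < t & f (x + t *: v) - f x = 'D_v f (x + a *: v) * t.
Proof.
move=> t0 df.
have [||a ain e] := @MVT R (fun h => f (x + h *: v))
  (fun h => 'D_v f (x + h *: v)) 0 t t0.
- move=> a; rewrite in_itv /= => /andP[a0 at1].
  by apply: is_derive_line; apply: df; rewrite !ltW.
- apply: derivable_within_continuous => a; rewrite in_itv /= => aI.
  by have [] := is_derive_line (df a aI).
by move: ain e; rewrite in_itv/= subr0 scale0r addr0; exists a.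
Qed.

(** The second difference is the increment along [u] of [f (y + t *: v) - f y]. The mean value
    theorem is applied to this function along [u], then to ['D_u f] along [v]. *)
Lemma second_difference f x u v (t : R) : 0 < t ->
  (forall a b, 0 <= a <= t -> 0 <= b <= t ->
    derivable f (x + a *: u + b *: v) u /\
    derivable ('D_u f) (x + a *: u + b *: v) v) ->
  exists a b, [/\ 0 < a < t, 0 < b < t &
    f (x + t *: u + t *: v) - f (x + t *: u) - f (x + t *: v) + f x =
    'D_v ('D_u f) (x + a *: u + b *: v) * t ^+ 2].
Proof.
move=> t0 df.
have t00 : 0 <= (0 : R) <= t by rewrite lexx ltW.
have tt : 0 <= t <= t by rewrite lexx ltW.
pose g y := f (y + t *: v) - f y.
have dg a : 0 <= a <= t ->
    is_derive (x + a *: u) u g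
      ('D_u f (x + a *: u + t *: v) - 'D_u f (x + a *: u)).
  move=> at1; have [d1 _] := df a t at1 tt.
  have [d0 _] := df a 0 at1 t00; rewrite scale0r addr0 in d0.
  have E : (fun h => h^-1 *: (((fun y => f (y + t *: v)) \o shift (x + a *: u))
      (h *: u) - f (x + a *: u + t *: v))) =
    (fun h => h^-1 *: ((f \o shift (x + a *: u + t *: v)) (h *: u) -
      f (x + a *: u + t *: v))).
    by apply/funext => h /=; rewrite !addrA.
  have d2 : is_derive (x + a *: u) u (fun y => f (y + t *: v))
      ('D_u f (x + a *: u + t *: v)).
    by apply: DeriveDef; [rewrite /derivable E|rewrite /derive E].
  by apply: is_deriveB; exact: derivableP.
have [a at1 ea] := @MVT_line g x u t t0
  (fun a at1 => @ex_derive _ _ _ _ _ _ _ (dg a at1)).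
have at2 : 0 <= a <= t by case/andP: at1 => *; rewrite !ltW.
rewrite (@derive_val _ _ _ _ _ _ _ (dg a at2)) in ea.
have [b bt1 eb] := @MVT_line ('D_u f) (x + a *: u) v t t0
  (fun b bt1 => (df a b at2 bt1).2).
exists a, b; split=> //.
by rewrite eb /g in ea; rewrite expr2 mulrA -ea; ring.
Qed.

Lemma nbhs_parallelogram (N : set V) x u v : nbhs x N ->
  exists2 t : R, 0 < t &
    forall a b, 0 <= a <= t -> 0 <= b <= t -> N (x + a *: u + b *: v).
Proof.
move=> /nbhs_ballP[r /= r0 xN].
have k0 : 0 < `|u| + `|v| + 1 by rewrite ltr_wpDl// addr_ge0.
(* With this [t] the displacement has norm at most [r / 2]; the [+ 1] keeps the denominator positive
   when [u] and [v] both vanish. *)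
exists (r / 2 / (`|u| + `|v| + 1)) => [|a b /andP[a0 at1] /andP[b0 bt1]].
  by rewrite !divr_gt0.
apply: xN; rewrite -ball_normE /= -addrA opprD addrA subrr add0r normrN.
apply: (@le_lt_trans _ _ (r / 2)); last by lra.
rewrite (le_trans (ler_normD _ _))// !normrZ !ger0_norm//.
rewrite -[leRHS](@divfK _ (`|u| + `|v| + 1)) ?gt_eqF//.
set t := _ / _ in at1 bt1 *.
have t0 : 0 <= t by apply: le_trans at1.
by rewrite mulrDr mulr1 -[leLHS]addr0 lerD// mulrDr lerD// ler_wpM2r.
Qed.

(** The second difference is symmetric in [u] and [v], so the two mixed derivatives take a common
    value at two points of a small parallelogram; continuity at [x] carries the equality to [x]. *)
Lemma derive_comm f x u v :
  (\forall y \near x, [/\ derivable f y u, derivable f y v,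
     derivable ('D_u f) y v & derivable ('D_v f) y u]) ->
  {for x, continuous ('D_v ('D_u f))} -> {for x, continuous ('D_u ('D_v f))} ->
  'D_v ('D_u f) x = 'D_u ('D_v f) x.
Proof.
move=> df cvu cuv; apply/eqP; rewrite -subr_eq0 -normr_le0.
apply/ler_addgt0Pl => e e0; rewrite addr0.
have close_enough (c d c' d' : R) :
    c' = d' -> `|c - c'| < e / 2 -> `|d - d'| < e / 2 -> `|c - d| <= e.
  move=> ->; rewrite !ltr_norml => /andP[? ?] /andP[? ?].
  by rewrite ler_norml; apply/andP; split; lra.
have e20 : 0 < e / 2 by rewrite divr_gt0.
have Nvu : \forall y \near x, `|'D_v ('D_u f) x - 'D_v ('D_u f) y| < e / 2.
  by move/cvgrPdist_lt : cvu => /(_ _ e20).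
have Nuv : \forall y \near x, `|'D_u ('D_v f) x - 'D_u ('D_v f) y| < e / 2.
  by move/cvgrPdist_lt : cuv => /(_ _ e20).
have [t t0 Nt] := nbhs_parallelogram u v (filterI df (filterI Nvu Nuv)).
have [|a [b [at1 bt1 e1]]] := @second_difference f x u v t t0.
  by move=> a b at1 bt1; have [[]] := Nt a b at1 bt1.
have [|b' [a' [bt2 at2 e2]]] := @second_difference f x v u t t0.
  move=> b' a' bt2 at2; have [[? ? ? ?] _] := Nt a' b' at2 bt2.
  by rewrite (_ : _ + _ + _ = x + a' *: u + b' *: v); last exact: addrAC.
have W (c : R) : 0 < c < t -> 0 <= c <= t by case/andP=> *; rewrite !ltW.
have [_ [N1 _]] := Nt a b (W _ at1) (W _ bt1).
have [_ [_ N2]] := Nt a' b' (W _ at2) (W _ bt2).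
have E : 'D_v ('D_u f) (x + a *: u + b *: v) =
         'D_u ('D_v f) (x + a' *: u + b' *: v).
  apply: (@mulIf _ (t ^+ 2)); first by rewrite expf_neq0// gt_eqF.
  rewrite (_ : x + a' *: u + _ = x + b' *: v + a' *: u); last exact: addrAC.
  apply: etrans (esym e1) (etrans _ e2).
  rewrite (_ : x + t *: v + _ = x + t *: u + t *: v); last exact: addrAC.
  by congr (_ + f x); exact: addrAC.
exact: close_enough E N1 N2.
Qed.

End Schwarz.

(** * From a convex relation to a linear map *)

(** [X a b s] will mean that some distribution has expected identification value [(a, b)] and
    directional derivative [s] of its expected score. If a conic combination of points of [X] lies
    over the origin, normalising the weights gives a point of [X] there, so its third coordinate
    vanishes as well. *)
Lemma conic_linear (R : realFieldType) (X : R -> R -> R -> Prop)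
    (e p p' q q' : R) : 0 < e ->
  (forall a b s a' b' s' t, X a b s -> X a' b' s' -> 0 <= t <= 1 ->
    X (t * a + (1 - t) * a') (t * b + (1 - t) * b') (t * s + (1 - t) * s')) ->
  (forall s, X 0 0 s -> s = 0) ->
  X e 0 p -> X (- e) 0 p' -> X 0 e q -> X 0 (- e) q' ->
  forall a b s, X a b s -> e * s = p * a + q * b.
Proof.
move=> e0 Xconv X0 Xp Xp' Xq Xq'.
have cone w1 w2 a1 b1 s1 a2 b2 s2 : 0 < w1 -> 0 <= w2 ->
    X a1 b1 s1 -> X a2 b2 s2 ->
    X ((w1 * a1 + w2 * a2) / (w1 + w2)) ((w1 * b1 + w2 * b2) / (w1 + w2))
      ((w1 * s1 + w2 * s2) / (w1 + w2)).
  move=> w10 w20 X1 X2; have w0 : 0 < w1 + w2 by rewrite ltr_wpDr.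
  have E c1 c2 : (w1 * c1 + w2 * c2) / (w1 + w2) =
      w1 / (w1 + w2) * c1 + (1 - w1 / (w1 + w2)) * c2.
    by field; rewrite gt_eqF.
  rewrite !E; apply: Xconv => //.
  apply/andP; split; first by apply: divr_ge0; exact: ltW.
  by rewrite ler_pdivrMr// mul1r lerDl.
have cone3 w1 w2 w3 a1 b1 s1 a2 b2 s2 a3 b3 s3 :
    0 < w1 -> 0 <= w2 -> 0 <= w3 -> X a1 b1 s1 -> X a2 b2 s2 -> X a3 b3 s3 ->
    w1 * a1 + w2 * a2 + w3 * a3 = 0 -> w1 * b1 + w2 * b2 + w3 * b3 = 0 ->
    w1 * s1 + w2 * s2 + w3 * s3 = 0.
  move=> w10 w20 w30 X1 X2 X3 ea eb.
  have w120 : 0 < w1 + w2 by rewrite ltr_wpDr.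
  have := cone _ _ _ _ _ _ _ _ w120 w30 (cone _ _ _ _ _ _ _ _ w10 w20 X1 X2) X3.
  rewrite ![(w1 + w2) * (_ / _)]mulrC !divfK ?gt_eqF// ea eb mul0r => /X0/eqP.
  rewrite mulf_eq0 invr_eq0 [w1 + w2 + w3 == 0]gt_eqF ?orbF ?ltr_wpDr//.
  by move/eqP.
(* Opposite points of an axis cancel with weights 1 and 1; the third point is a dummy of weight
   0. *)
have ep' : p' = - p.
  have /(_ _ _)/eqP := cone3 1 1 0 _ _ _ _ _ _ _ _ _
    ltr01 ler01 (lexx _) Xp Xp' Xp.
  rewrite !mul1r !mul0r !addr0 subrr addr_eq0 => /(_ _ _)/eqP->//.
  by rewrite opprK.
have eq' : q' = - q.
  have /(_ _ _)/eqP := cone3 1 1 0 _ _ _ _ _ _ _ _ _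
    ltr01 ler01 (lexx _) Xq Xq' Xq.
  rewrite !mul1r !mul0r !addr0 subrr addr_eq0 => /(_ _ _)/eqP->//.
  by rewrite opprK.
move=> a b s Xabs.
(* In each quadrant [(a, b, s)] gets weight [e], and the axis points on the opposite side get
   weights [|a|] and [|b|], which cancels the first two coordinates. *)
have [a0|a0] := leP 0 a; have [b0|b0] := leP 0 b.
- have := cone3 e a b _ _ _ _ _ _ _ _ _ e0 a0 b0 Xabs Xp' Xq'.
  rewrite ep' eq' => H; apply/eqP; rewrite -subr_eq0 -[0]H; last 2 first.
  + by ring.
  + by ring.
  + by apply/eqP; ring.
- have b0' : 0 <= - b by lra.
  have := cone3 e a (- b) _ _ _ _ _ _ _ _ _ e0 a0 b0' Xabs Xp' Xq.
  rewrite ep'; lra.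
- have a0' : 0 <= - a by lra.
  have := cone3 e (- a) b _ _ _ _ _ _ _ _ _ e0 a0' b0 Xabs Xp Xq'.
  rewrite eq'; lra.
- have a0' : 0 <= - a by lra.
  have b0' : 0 <= - b by lra.
  have := cone3 e (- a) (- b) _ _ _ _ _ _ _ _ _ e0 a0' b0' Xabs Xp Xq.
  lra.
Qed.

(** * Coverage of symmetric intervals *)

Section IncreasingContinuous.
Context {R : realType}.
Implicit Types (F : distr R) (a b c : R).

Lemma dfunE F a : F `]-oo, a]%classic = (dfun F a)%:E.
Proof. by rewrite /dfun fineK// fin_num_measure. Qed.

Lemma distr_itvoc F a b : a <= b ->
  F `]a, b]%classic = (dfun F b - dfun F a)%:E.
Proof.
move=> ab; apply/eqP; rewrite EFinB -!dfunE eq_sym sube_eq ?fin_num_measure//.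
  rewrite -measureU//; last first.
    apply/seteqP; split=> // x [] /=; rewrite !in_itv/= => /andP[ax _].
    by move=> xa; have := lt_le_trans ax xa; rewrite ltxx.
  apply/eqP; congr (F _); apply/seteqP; split=> x /=; rewrite !in_itv/=.
    by move=> xb; have [xa|ax] := leP (x : R) a; [right|left; exact/andP].
  by case=> [/andP[]//|xa]; exact: le_trans ab.
by rewrite fin_num_adde_defr// fin_num_measure.
Qed.

(** Continuity excludes an atom at [a]: the closed interval lies in []a - d / 2, b]], which for
    small [d] has at most [e] more mass than []a, b]]. *)
Lemma distr_itvcc F a b : continuous (dfun F) -> a <= b ->
  F `[a, b]%classic = (dfun F b - dfun F a)%:E.
Proof.
move=> cF ab; apply/eqP; rewrite eq_le; apply/andP; split; last first.
  rewrite -distr_itvoc// le_measure ?inE//=.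
  by apply: subset_itvr; rewrite bnd_simp.
have : fine (F `[a, b]%classic) <= dfun F b - dfun F a.
  apply/ler_addgt0Pl => e e0.
  have /cvgrPdist_lt/(_ _ e0) /nbhs_ballP[d /= d0 Fd] := cF a.
  have ad : a - d / 2 < a by rewrite ltrBlDr ltrDl divr_gt0.
  have : ball a d (a - d / 2).
    by rewrite -ball_normE/= subKr gtr0_norm ?divr_gt0//; lra.
  move=> /Fd /ltr_normlP[_ Fa].
  have : (F `[a, b]%classic <= F `](a - d / 2)%R, b]%classic)%E.
    rewrite le_measure ?inE//=.
    by apply: subset_itvr; rewrite bnd_simp.
  rewrite distr_itvoc; last by rewrite (le_trans (ltW ad)).
  rewrite -[F `[a, b]%classic]fineK ?fin_num_measure// lee_fin.
  by move=> /le_trans; apply; lra.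
by rewrite -[F `[a, b]%classic]fineK ?fin_num_measure.
Qed.

Lemma distr_itv_cover F c0 alpha : alpha < 1 ->
  exists2 c, 0 <= c & (alpha%:E <= F `[(c0 - c)%R, (c0 + c)%R]%classic)%E.
Proof.
move=> a1.
have : (fun n : nat => F `[- n%:R, n%:R]%classic) @ \oo --> F setT.
  rewrite -(@bigcup_itvT R true false).
  apply: nondecreasing_cvg_mu => //=; first exact: bigcup_measurable.
  move=> n k nk; apply/subsetPset => x /=; rewrite !in_itv/= => /andP[x1 x2].
  by rewrite (le_trans x2) ?ler_nat// andbT (le_trans _ x1)// lerN2 ler_nat.
rewrite probability_setT => cvg1.
have /cvg1 : nbhs (1%:E : \bar R) [set x | (alpha%:E < x)%E].
  apply: open_nbhs_nbhs; split=> /=; last by rewrite lte_fin.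
  exact: open_ereal_gt_ereal.
case=> n _ /(_ n (leqnn _)) /= /ltW an.
(* This radius makes the interval around [c0] contain [[-n, n]], whose mass is at least [alpha]. *)
exists (n%:R + `|c0|); first by rewrite addr_ge0.
apply: (le_trans an); rewrite le_measure ?inE//= => x /=.
rewrite !in_itv/= => /andP[x1 x2].
have /lerNnormlW := lexx `|c0|.
have := ler_norm c0; lra.
Qed.

(** The coverage [g] is continuous and strictly increasing, vanishes at 0 and eventually reaches
    [alpha], so it takes the value [alpha] exactly once, at a positive radius. *)
Lemma inc_cont_coverage F c0 alpha : inc_cont F -> 0 < alpha < 1 ->
  0 < d_ alpha F c0 /\
  forall c, 0 <= c ->
    F `[c0 - c, c0 + c]%classic = alpha%:E <-> c = d_ alpha F c0.
Proof.
move=> [cF iF] /andP[a0 a1].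
pose g c := dfun F (c0 + c) - dfun F (c0 - c).
have gE c : 0 <= c -> F `[c0 - c, c0 + c]%classic = (g c)%:E.
  by move=> c_ge0; rewrite distr_itvcc//; lra.
have ig : {mono g : x y / x <= y}.
  apply: le_mono => x y xy; apply: ltrD; first by apply: iF; rewrite ltrD2l.
  by rewrite ltrN2; apply: iF; rewrite ltrD2l ltrN2.
have cg : continuous g.
  move=> x; apply: cvgB.
    apply: (@continuous_comp _ _ _ (fun c => c0 + c) (dfun F)); last exact: cF.
    by apply: cvgD; [exact: cvg_cst|exact: cvg_id].
  apply: (@continuous_comp _ _ _ (fun c => c0 - c) (dfun F)); last exact: cF.
  by apply: cvgB; [exact: cvg_cst|exact: cvg_id].
have g0 : g 0 = 0 by rewrite /g addr0 subr0 subrr.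
have [c c_ge0 ac] := distr_itv_cover F c0 a1.
rewrite gE// lee_fin in ac.
have [||k kc gk] := @IVT R g 0 c alpha c_ge0.
- exact: continuous_subspaceT.
- have gc : g 0 <= g c by rewrite ig.
  by rewrite min_l// max_r// g0 ltW.
have k0 : 0 < k by rewrite -(leW_mono ig) g0 gk.
have dk : d_ alpha F c0 = k.
  (* By monotonicity of [g], the radii with coverage at least [alpha] form the half-line from
     [k]. *)
  have -> : d_ alpha F c0 = inf `[k, +oo[%classic; last first.
    by rewrite inf_itv.
  congr inf; apply/seteqP; split=> x /=; rewrite in_itv/= andbT.
    by move=> [x0]; rewrite gE// lee_fin -gk ig.
  move=> kx; have x0 : 0 <= x by rewrite (le_trans (ltW k0)).
  by split=> //; rewrite gE// lee_fin -gk ig.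
rewrite dk; split=> // x x0; rewrite gE// -gk; split=> [[]|->//].
exact: (inc_inj ig).
Qed.

Lemma pred_identification_coverage F (Vm : R -> R -> R) alpha (z : R * R) :
  (F.-integrable setT (fun y => (pred_identification alpha Vm z y).2%:E)) /\
  \int[F]_y (pred_identification alpha Vm z y).2 =
  fine (F `[z.1 - z.2, z.1 + z.2]%classic) - alpha.
Proof.
have mI : measurable (`[z.1 - z.2, z.1 + z.2] : set R) by [].
have I1 : F.-integrable setT (EFin \o \1_`[z.1 - z.2, z.1 + z.2]).
  exact: integrable_indic.
have Ia : F.-integrable setT (EFin \o cst alpha).
  exact: finite_measure_integrable_cst.
split; first exact: (integrableB measurableT I1 Ia).
rewrite /pred_identification /= RintegralB//.
rewrite Rintegral_cst//; congr (_ - _).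
  by rewrite /Rintegral integral_indic// setIT.
rewrite -[RHS]mulr1; congr (alpha * _).
have FT : F setT = 1%E := probability_setT F.
by apply: etrans (congr1 fine FT) _.
Qed.

End IncreasingContinuous.

(** The first component forces [x = m F]; the second is then the excess coverage around the right
    midpoint, which vanishes only at the half-length. *)
Lemma pred_functional_identifiable (R : realType) (alpha : R)
    (M : set (distr R)) (m : distr R -> R) (Vm : R -> R -> R) :
  0 < alpha < 1 -> strict_identification M m Vm ->
  strict_identification2 action_domain (M `&` inc_cont)
    (pred_functional alpha m) (pred_identification alpha Vm).
Proof.
move=> alpha01 HVm; split=> [F [_ FI]|[x c] F /= c0 [MF FI]].
  by have [/ltW] := inc_cont_coverage (m F) FI alpha01.
have [d0 dP] := inc_cont_coverage x FI alpha01.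
have [I2 e2] := pred_identification_coverage F Vm alpha (x, c).
have [I1 e1] := HVm x F MF.
split=> //; rewrite /barV2 e2 /=.
rewrite -[X in (X, _)]/(barV Vm x F) /pred_functional /pred_halflength.
split=> [[/e1 xm /eqP]|[/[dup] xm <- cd]].
  rewrite subr_eq0 => /eqP e; rewrite -xm; congr (_, _).
  by apply/(dP _ c0); rewrite -e fineK// fin_num_measure.
congr (_, _); first exact/e1.
by move/(dP _ c0) : cd => ->; rewrite /= subrr.
Qed.

(** * Directional derivatives in the plane *)

Section PlaneDerivatives.
Context {R : realType}.
Implicit Types (z v : R * R) (F : distr R).

Lemma nbhs_open_domain z : open_domain z -> nbhs z (@open_domain R).
Proof.
move=> z0; apply: (@cvg_snd _ _ (nbhs z.1) (nbhs z.2)) (fun y => 0 < y) _.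
exact: lt_nbhsr.
Qed.

Lemma differentiable_comp_fst (V : normedModType R) (f : V -> R * R) (x : V) :
  differentiable f x -> differentiable (fun y => (f y).1) x.
Proof.
move=> df; apply: (@differentiable_comp _ _ _ _ f fst) => //.
by apply: linear_differentiable => y; exact: cvg_fst.
Qed.

Lemma differentiable_comp_snd (V : normedModType R) (f : V -> R * R) (x : V) :
  differentiable f x -> differentiable (fun y => (f y).2) x.
Proof.
move=> df; apply: (@differentiable_comp _ _ _ _ f snd) => //.
by apply: linear_differentiable => y; exact: cvg_snd.
Qed.

Lemma derive_dirD (V : normedModType R) (f : V -> R) (x u v : V) :
  differentiable f x -> 'D_(u + v) f x = 'D_u f x + 'D_v f x.
Proof. by move=> df; rewrite !deriveE// linearD. Qed.

Lemma derive_dirN (V : normedModType R) (f : V -> R) (x v : V) :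
  differentiable f x -> 'D_(- v) f x = - 'D_v f x.
Proof. by move=> df; rewrite !deriveE// linearN. Qed.

(** The identity says that the determinant with rows [(f, v1, v2)], [(p, a1, a2)], [(q, b1, b2)]
    vanishes near [x]. As the first row is zero at [x], only its derivatives survive the product
    rule. *)
Lemma derive_cramer (V : normedModType R) (f p q v1 v2 a1 a2 b1 b2 : V -> R)
    (x w : V) (e : R) : e != 0 ->
  derivable f x w -> derivable p x w -> derivable q x w ->
  derivable v1 x w -> derivable v2 x w -> derivable a1 x w ->
  derivable a2 x w -> derivable b1 x w -> derivable b2 x w ->
  (\near x, f x * (a1 x * b2 x - a2 x * b1 x) =
     p x * (v1 x * b2 x - v2 x * b1 x) + q x * (a1 x * v2 x - a2 x * v1 x)) ->
  f x = 0 -> v1 x = 0 -> v2 x = 0 -> a1 x = e -> a2 x = 0 -> b1 x = 0 ->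
  b2 x = e ->
  e * 'D_w f x = p x * 'D_w v1 x + q x * 'D_w v2 x.
Proof.
move=> e0 /derivableP df /derivableP dp /derivableP dq /derivableP dv1
  /derivableP dv2 /derivableP da1 /derivableP da2 /derivableP db1
  /derivableP db2 E fx v1x v2x a1x a2x b1x b2x.
have dl := is_deriveM df (is_deriveB (is_deriveM da1 db2) (is_deriveM da2 db1)).
have dr := is_deriveD
  (is_deriveM dp (is_deriveB (is_deriveM dv1 db2) (is_deriveM dv2 db1)))
  (is_deriveM dq (is_deriveB (is_deriveM da1 dv2) (is_deriveM da2 dv1))).
have := near_eq_derive w E.
rewrite [LHS](@derive_val _ _ _ _ _ _ _ dl) [RHS](@derive_val _ _ _ _ _ _ _ dr).
rewrite /= ?fctE fx v1x v2x a1x a2x b1x b2x ?mul0r ?mulr0 ?add0r ?addr0 ?subr0.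
rewrite /GRing.scale /= ?mul0r ?mulr0 ?add0r ?addr0 ?subr0 => eE.
by apply: (mulfI e0); rewrite mulrA eE; ring.
Qed.

Lemma derive_fst_component (f : R -> R) z :
  'D_(1, 0) (fun z => f z.1) z = f^`()%classic z.1.
Proof.
have E : (fun h : R => h^-1 *: (((fun z => f z.1) \o shift z) (h *: (1, 0)) -
    f z.1)) = (fun h => h^-1 *: (f (h + z.1) - f z.1)).
  by apply/funext => h /=; rewrite [h *: 1]mulr1.
by rewrite /derive E.
Qed.

Lemma derive_fst_component0 (f : R -> R) z :
  'D_(0, 1) (fun z => f z.1) z = 0.
Proof.
rewrite /derive (_ : (fun h => _) = cst 0) ?lim_cst//.
by apply/funext => h /=; rewrite [h *: 0]mulr0 add0r subrr scaler0.
Qed.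

(** In this direction [z.1 + z.2] moves at unit speed and [z.1 - z.2] is fixed, so the planar
    difference quotients are those of [f]. Derivability of [f] is thereby a conclusion. *)
Lemma is_derive_sum_direction (f : R -> R) (c : R) z :
  derivable (fun z => f (z.1 + z.2) - f (z.1 - z.2) - c) z (2^-1, 2^-1) ->
  is_derive (z.1 + z.2) 1 f
    ('D_(2^-1, 2^-1) (fun z => f (z.1 + z.2) - f (z.1 - z.2) - c) z).
Proof.
set g := fun z => _.
have E : (fun h : R => h^-1 *: ((f \o shift (z.1 + z.2)) (h *: 1) -
    f (z.1 + z.2)))
  = (fun h => h^-1 *: ((g \o shift z) (h *: (2^-1, 2^-1)) - g z)).
  apply/funext => h; rewrite /g /=; congr (_ *: _).
  rewrite (_ : h *: 1 + (z.1 + z.2) = h *: 2^-1 + z.1 + (h *: 2^-1 + z.2)).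
    rewrite (_ : h *: 2^-1 + z.1 - (h *: 2^-1 + z.2) = z.1 - z.2); first ring.
    by ring.
  by rewrite /GRing.scale /=; field.
by move=> dg; apply: DeriveDef; [rewrite /derivable E|rewrite /derive E].
Qed.

Lemma is_derive_diff_direction (f : R -> R) (c : R) z :
  derivable (fun z => f (z.1 + z.2) - f (z.1 - z.2) - c) z (2^-1, - 2^-1) ->
  is_derive (z.1 - z.2) 1 f
    (- 'D_(2^-1, - 2^-1) (fun z => f (z.1 + z.2) - f (z.1 - z.2) - c) z).
Proof.
set g := fun z => _ => dg.
(* Here the sum is fixed and the difference moves; [f (z.1 - z.2)] enters [g] with a minus sign,
   hence [- f]. *)
have E : (fun h : R => h^-1 *: (((- f) \o shift (z.1 - z.2)) (h *: 1) -
    (- f) (z.1 - z.2)))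
  = (fun h => h^-1 *: ((g \o shift z) (h *: (2^-1, - 2^-1)) - g z)).
  apply/funext => h; rewrite /g /=; congr (_ *: _); rewrite !fctE /=.
  rewrite (_ : h *: 1 + (z.1 - z.2) = h *: 2^-1 + z.1 - (h *: - 2^-1 + z.2)).
    rewrite (_ : h *: 2^-1 + z.1 + (h *: - 2^-1 + z.2) = z.1 + z.2); first ring.
    by rewrite /GRing.scale /=; ring.
  by rewrite /GRing.scale /=; field.
have dNf : is_derive (z.1 - z.2) 1 (- f) ('D_(2^-1, - 2^-1) g z).
  by apply: DeriveDef; [rewrite /derivable E|rewrite /derive E].
by have := is_deriveN dNf; rewrite opprK.
Qed.

(** A density is tied to the derivative of [dfun F] only where the latter exists; the two diagonal
    directions give existence at both endpoints. *)
Lemma coverage_derivatives F (f : R -> R) (g : R * R -> R) (c : R) z :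
  is_density F f -> differentiable g z ->
  (\near z, g z = dfun F (z.1 + z.2) - dfun F (z.1 - z.2) - c) ->
  'D_(1, 0) g z = f (z.1 + z.2) - f (z.1 - z.2) /\
  'D_(0, 1) g z = f (z.1 + z.2) + f (z.1 - z.2).
Proof.
move=> [_ _ _ dfF] dg gE.
have d1 : derivable (fun z => dfun F (z.1 + z.2) - dfun F (z.1 - z.2) - c) z
    (2^-1, 2^-1).
  by apply: near_eq_derivable gE _; exact: diff_derivable.
have d2 : derivable (fun z => dfun F (z.1 + z.2) - dfun F (z.1 - z.2) - c) z
    (2^-1, - 2^-1).
  by apply: near_eq_derivable gE _; exact: diff_derivable.
have [dp ep] := is_derive_sum_direction d1.
have [dm em] := is_derive_diff_direction d2.
rewrite !dfF// !derive1E ep em -!(near_eq_derive _ gE).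
(* The axis directions are the sum and the difference of the two diagonal ones. *)
rewrite opprK -derive_dirN// -!derive_dirD//; split;
  by congr derive; apply/pair_equal_spec; split=> /=; field.
Qed.

End PlaneDerivatives.

(** Fermat's rule on the line through [x] in direction [w]. *)
Lemma derive_at_local_min (R : realType) (V : normedModType R) (f : V -> R)
    (x w : V) : (\near x, derivable f x w) -> (\forall y \near x, f x <= f y) ->
  'D_w f x = 0.
Proof.
move=> df fmin.
have line : (fun h : R => x + h *: w) @ 0 --> x.
  rewrite -[X in _ --> X]addr0 -[X in _ + X](scale0r w).
  by apply: cvgD; [exact: cvg_cst|apply: cvgZr_tmp; exact: cvg_id].
have /nbhs_ballP[r /= r0 xr] :
  nbhs (0 : R) [set h | derivable f (x + h *: w) w /\ f x <= f (x + h *: w)].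
  exact: line (filterI df fmin).
have inr t : t \in `]- r, r[ ->
    derivable f (x + t *: w) w /\ f x <= f (x + t *: w).
  rewrite in_itv/= -ltr_norml => tr; apply: xr.
  by rewrite -ball_normE/= sub0r normrN.
have in0 : 0 \in `]- r, r[ by rewrite in_itv/= oppr_lt0 r0.
have [||//|t tr|d e] := @derive1_at_min R (fun h => f (x + h *: w)) (- r) r 0.
- by rewrite ge0_cp// ltW.
- by move=> t /inr[/is_derive_line[]].
- by rewrite scale0r addr0; exact: (inr t tr).2.
- have /is_derive_line[_] := (inr 0 in0).1.
  by rewrite e scale0r addr0.
Qed.

(** * Osband's principle *)

Section Osband.
Context {R : realType} {M : set (distr R)}.
Variables (T : distr R -> R * R) (V : R * R -> R -> R * R).
Variable S : R * R -> R -> \bar R.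
Hypothesis Mconvex : convex_class M.
Hypothesis Vident : strict_identification2 action_domain M T V.
Hypothesis Vhull : forall z, open_domain z -> exists F1 F2 F3,
  [/\ M F1, M F2, M F3 &
    ((convex_hull [set barV2 V z F1; barV2 V z F2; barV2 V z F3])°
          : set (R * R)) 0].
Hypothesis VC1 : forall F, M F -> C1_on open_domain (fun z => barV2 V z F).
Hypothesis Sscoring : scoring_function action_domain M S.
Hypothesis Sconsistent : strictly_consistent action_domain M T S.
Hypothesis SC2 : forall F, M F ->
  (forall z, open_domain z -> barS S z F \is a fin_num) /\
  C2_on open_domain (fun z => fine (barS S z F)).

Let s F z := fine (barS S z F).

Let open_action (z : R * R) : open_domain z -> action_domain z.
Proof. exact: ltW. Qed.

(** Scores are extended reals: their integrability, needed for linearity, comes from finiteness of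
    [barS] on the open domain. Hence the smaller range of [z] in the last clause. *)
Let mixture F G t : M F -> M G -> 0 <= t <= 1 -> exists H,
  [/\ M H,
    forall z, action_domain z ->
      (barV2 V z H).1 = t * (barV2 V z F).1 + (1 - t) * (barV2 V z G).1 /\
      (barV2 V z H).2 = t * (barV2 V z F).2 + (1 - t) * (barV2 V z G).2 &
    forall z, open_domain z -> s H z = t * s F z + (1 - t) * s G z].
Proof.
move=> MF MG t01; have [H MH HE] := Mconvex MF MG t01.
have mixR (f : R -> R) : F.-integrable setT (EFin \o f) ->
    G.-integrable setT (EFin \o f) ->
    \int[H]_y f y = t * \int[F]_y f y + (1 - t) * \int[G]_y f y.
  move=> Ff Gf; rewrite /Rintegral (integral_mixture t01 HE Ff Gf).
  have /fineK {1}<- := integrable_fin_num measurableT Ff.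
  by have /fineK {1}<- := integrable_fin_num measurableT Gf.
exists H; split=> // [z Az|z Uz].
  have [F1 F2 _] := Vident.2 z F Az MF; have [G1 G2 _] := Vident.2 z G Az MG.
  by split; apply: mixR.
have Fs := (SC2 MF).1 z Uz; have Gs := (SC2 MG).1 z Uz.
have Az := open_action Uz.
have FI := integrable_of_finite (Sscoring.2 z F Az MF).1 Fs.
have GI := integrable_of_finite (Sscoring.2 z G Az MG).1 Gs.
rewrite /s {1}/barS (integral_mixture t01 HE FI GI).
by rewrite -/(barS S z F) -/(barS S z G) -(fineK Fs) -(fineK Gs).
Qed.

(** By [mixture] the values attained at [z] form a convex set, so they contain the hull of the three
    given ones and a ball around 0. *)
Let reach z : open_domain z -> exists2 e, 0 < e &
  forall v : R * R, `|v| <= e -> exists2 F, M F & barV2 V z F = v.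
Proof.
move=> Uz; have [F1 [F2 [F3 [M1 M2 M3]]]] := Vhull Uz.
rewrite /interior/= => /nbhs_ballP[e /= e0 eV]; exists (e / 2).
  by rewrite divr_gt0.
move=> v ve; have /eV : ball 0 e v.
  by rewrite -ball_normE/= sub0r normrN (le_lt_trans ve)//; lra.
(* The hull is the intersection of all convex supersets; it is instantiated at the set of attained
   values. *)
move=> /(_ [set v | exists2 F, M F & barV2 V z F = v]); apply.
split; last by move=> _ [[|]|] ->; [exists F1|exists F2|exists F3].
move=> _ _ k /set_mem[F MF <-] /set_mem[G MG <-]; apply/mem_set.
have k01 : 0 <= k%:num <= 1 by apply/andP; split; [exact: ge0|exact: le1].
have [H [MH VH _]] := mixture MF MG k01.
exists H => //; have [e1 e2] := VH z (open_action Uz).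
by rewrite [LHS]surjective_pairing e1 e2.
Qed.

Let s_derivable F z w : M F -> open_domain z -> derivable (s F) z w.
Proof.
by move=> MF Uz; apply: diff_derivable; have [] := (SC2 MF).2.1 z Uz.
Qed.

Let V_zero F z : M F -> open_domain z -> barV2 V z F = 0 <-> z = T F.
Proof. by move=> MF Uz; have [] := Vident.2 z F (open_action Uz) MF. Qed.

Let s_critical F z w : M F -> open_domain z -> barV2 V z F = 0 ->
  'D_w (s F) z = 0.
Proof.
move=> MF Uz /(V_zero MF Uz) zT.
apply: derive_at_local_min; have := nbhs_open_domain Uz; apply: filterS => y Uy.
  exact: s_derivable.
have := (Sconsistent (open_action Uy) MF).1; rewrite -zT.
have /fineK <- := (SC2 MF).1 z Uz; have /fineK <- := (SC2 MF).1 y Uy.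
by rewrite lee_fin.
Qed.

(** This is [conic_linear]: convexity comes from [mixture], and vanishing over the origin from
    [s_critical]. The coefficients are read off at distributions with values [(e, 0)] and
    [(0, e)]. *)
Let gradient_linear z w : open_domain z -> exists h1 h2 : R, forall F, M F ->
  'D_w (s F) z = h1 * (barV2 V z F).1 + h2 * (barV2 V z F).2.
Proof.
move=> Uz; have [e e0 eV] := reach Uz.
have e_ge0 := ltW e0; have ne0 : e != 0 by rewrite gt_eqF.
have normE (a b : R) : `|a| <= e -> `|b| <= e -> `|(a, b)| <= e.
  by move=> ae be; rewrite prod_normE/= ge_max ae be.
have [|F1 M1 V1] := eV (e, 0); first by rewrite normE ?normr0// ger0_norm.
have [|F2 M2 V2] := eV (- e, 0).
  by rewrite normE ?normr0// normrN ger0_norm.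
have [|F3 M3 V3] := eV (0, e); first by rewrite normE ?normr0// ger0_norm.
have [|F4 M4 V4] := eV (0, - e).
  by rewrite normE ?normr0// normrN ger0_norm.
pose X a b c := exists F, [/\ M F, barV2 V z F = (a, b) & 'D_w (s F) z = c].
exists ('D_w (s F1) z / e), ('D_w (s F3) z / e) => F MF.
have -> : 'D_w (s F) z = ('D_w (s F1) z * (barV2 V z F).1 +
    'D_w (s F3) z * (barV2 V z F).2) / e; last by field.
apply: (mulfI ne0); rewrite [RHS]mulrC divfK//.
apply: (@conic_linear R X e _ ('D_w (s F2) z) _ ('D_w (s F4) z) e0).
- move=> a b c a' b' c' t [G [MG VG <-]] [G' [MG' VG' <-]] t01.
  have [H [MH VH sH]] := mixture MG MG' t01.
  exists H; split=> //.
    have [e1 e2] := VH z (open_action Uz).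
    by rewrite [LHS]surjective_pairing e1 e2 VG VG'.
  have sE : \near z, s H z = (t *: s G + (1 - t) *: s G') z.
    by have := nbhs_open_domain Uz; apply: filterS => y /sH.
  rewrite (near_eq_derive w sE).
  have dG := is_deriveZ t (derivableP (@s_derivable _ _ w MG Uz)).
  have dG' := is_deriveZ (1 - t) (derivableP (@s_derivable _ _ w MG' Uz)).
  exact: (@derive_val _ _ _ _ _ _ _ (is_deriveD dG dG')).
- by move=> c [G [MG VG <-]]; exact: s_critical.
- by exists F1.
- by exists F2.
- by exists F3.
- by exists F4.
- by exists F; split=> //; rewrite -surjective_pairing.
Qed.

(* By [gradient_linear] the vectors ('D_w s, V_1, V_2) of three distributions
   are linearly dependent at every point; differentiating the corresponding
   determinant at a zero of V avoids differentiating the matrix h. *)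
Lemma osband_hessian z w : open_domain z -> exists h1 h2 : R, forall F, M F ->
  'D_w (fun y => fine (barS S y F)) z =
    h1 * (barV2 V z F).1 + h2 * (barV2 V z F).2 /\
  (T F = z -> forall u, 'D_u ('D_w (fun y => fine (barS S y F))) z =
    h1 * 'D_u (fun y => (barV2 V y F).1) z +
    h2 * 'D_u (fun y => (barV2 V y F).2) z).
Proof.
move=> Uz; have [h1 [h2 hE]] := gradient_linear w Uz.
exists h1, h2 => F MF; split=> [|TF u]; first exact: hE.
have [e e0 eV] := reach Uz.
have e_ge0 := ltW e0; have ne0 : e != 0 by rewrite gt_eqF.
have [|F1 M1 V1] := eV (e, 0).
  by rewrite prod_normE/= ge_max normr0 ger0_norm ?lexx.
have [|F2 M2 V2] := eV (0, e).
  by rewrite prod_normE/= ge_max normr0 ger0_norm ?lexx// e_ge0.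
have VF : barV2 V z F = 0 by apply/(V_zero MF Uz).
have dV1 G : M G -> derivable (fun y => (barV2 V y G).1) z u.
  move=> MG; apply/diff_derivable/differentiable_comp_fst.
  by have [] := VC1 MG Uz.
have dV2 G : M G -> derivable (fun y => (barV2 V y G).2) z u.
  move=> MG; apply/diff_derivable/differentiable_comp_snd.
  by have [] := VC1 MG Uz.
have dDs G : M G -> derivable ('D_w (s G)) z u.
  by move=> MG; apply: diff_derivable; have [] := (SC2 MG).2.2 w z Uz.
have s1 := hE _ M1; have s2 := hE _ M2.
rewrite V1 /= mulr0 addr0 in s1; rewrite V2 /= mulr0 add0r in s2.
have := @derive_cramer R _ ('D_w (s F)) ('D_w (s F1)) ('D_w (s F2))
  (fun y => (barV2 V y F).1) (fun y => (barV2 V y F).2)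
  (fun y => (barV2 V y F1).1) (fun y => (barV2 V y F1).2)
  (fun y => (barV2 V y F2).1) (fun y => (barV2 V y F2).2) z u e ne0
  (dDs _ MF) (dDs _ M1) (dDs _ M2) (dV1 _ MF) (dV2 _ MF)
  (dV1 _ M1) (dV2 _ M1) (dV1 _ M2) (dV2 _ M2).
rewrite s1 s2 V1 V2 VF (hE _ MF) VF/= !mulr0 addr0 => E.
apply: (mulfI ne0); rewrite E//; first by ring.
have := nbhs_open_domain Uz; apply: filterS => y.
(* [k1] and [k2] vary with the nearby point [y], but drop out of the determinant. *)
move=> /(gradient_linear w)[k1 [k2 kE]].
by rewrite !kE// /barV2 /=; ring.
Qed.

End Osband.

(** * Identifiability, and nonexistence of smooth strictly consistent scores *)

Theorem proposition4p12 (R : realType) (alpha : R) (alpha01 : 0 < alpha < 1)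
  (M : set (distr R)) (m : distr R -> R) (Vm : R -> R -> R)
  (HVm : strict_identification M m Vm) :
  let b := pred_halflength alpha m in
  let Tm := pred_functional alpha m in
  let V := pred_identification alpha Vm in
  let M' := M `&` inc_cont in
  strict_identification2 action_domain M' Tm V
  /\
  (convex_class M' ->
   (forall z, open_domain z ->
      exists F1 F2 F3, [/\ M' F1, M' F2, M' F3 &
        ((convex_hull [set barV2 V z F1; barV2 V z F2; barV2 V z F3])°
          : set (R * R)) 0]) ->
   (forall F, M' F -> C1_on open_domain (fun z => barV2 V z F)) ->
   (forall ms bs : R, 0 < bs ->
      exists (F1 F2 F3 F4 : distr R) (f1 f2 f3 f4 : R -> R),
        let admissible F f :=
          [/\ M' F, is_density F f & (m F, b F) = (ms, bs)] in
        let dVm F := (fun x => barV Vm x F)^`()%classic ms in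
        [/\ admissible F1 f1, admissible F2 f2, admissible F3 f3
          & admissible F4 f4] /\
        [/\ dVm F1 = dVm F2 /\ dVm F2 = dVm F3,
            f1 (ms + bs) + f1 (ms - bs) = f2 (ms + bs) + f2 (ms - bs),
            f1 (ms + bs) + f1 (ms - bs) <> f3 (ms + bs) + f3 (ms - bs),
            f1 (ms + bs) - f1 (ms - bs) <> f2 (ms + bs) - f2 (ms - bs)
          & dVm F4 <> 0]) ->
   ~ exists S : R * R -> R -> \bar R,
       [/\ scoring_function action_domain M' S,
           strictly_consistent action_domain M' Tm S
         & forall F, M' F ->
             (forall z, open_domain z -> barS S z F \is a fin_num) /\
             C2_on open_domain (fun z => fine (barS S z F))]).
Proof.
move=> b Tm V M'; have Hid := pred_functional_identifiable alpha01 HVm.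
split=> // Mconvex Vhull VC1 Hdens [S [Sscoring Sconsistent SC2]].
have hess := osband_hessian Mconvex Hid Vhull VC1 Sscoring Sconsistent SC2.
have critical z F : open_domain z -> M' F ->
    'D_(0, 1) (fun y => fine (barS S y F)) z = 0.
  (* The directions [(1, 0)] and [(0, 1)] give the two rows of the matrix [h] at [z]. *)
  move=> Uz MF; have [h11 [h12 h1]] := hess z (1, 0) Uz.
  have [h21 [h22 h2]] := hess z (0, 1) Uz.
  have [F1 [F2 [F3 [F4 [f1 [f2 [f3 [f4 [[A1 A2 A3 A4]]]]]]]]]] :=
    Hdens z.1 z.2 Uz.
  pose dV G := (fun x => barV Vm x G)^`()%classic z.1.
  rewrite -![_^`()%classic z.1]/(dV _).
  move=> [[dV12 dV23] sum12 sum13 diff12 dV4].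
  (* Equality of the mixed second derivatives at [z = Tm G]. No [h11] term remains, since the first
     component of [V] does not depend on [z.2]. *)
  have sym G g : [/\ M' G, is_density G g & (m G, b G) = (z.1, z.2)] ->
      h12 * (g (z.1 + z.2) + g (z.1 - z.2)) =
      h21 * dV G + h22 * (g (z.1 + z.2) - g (z.1 - z.2)).
    move=> [MG gG TG]; have {}TG : Tm G = z by rewrite [RHS]surjective_pairing.
    have [_ /(_ TG (0, 1)) e1] := h1 G MG.
    have [_ /(_ TG (1, 0)) e2] := h2 G MG.
    have [dVz _] := VC1 G MG z Uz.
    have := @coverage_derivatives R G g (fun y => (barV2 V y G).2) alpha z gG
      (differentiable_comp_snd dVz).
    case=> [|d10 d01].
      have := nbhs_open_domain Uz; apply: filterS => y Uy.
      rewrite [LHS](pred_identification_coverage G Vm alpha y).2.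
      have y2 : 0 <= y.2 by exact: ltW.
      rewrite distr_itvcc//; first by have [_ []] := MG.
      by rewrite (le_trans (y := y.1))// ?lerDl// lerBlDr lerDl.
    have D10 := derive_fst_component (fun x => barV Vm x G) z.
    have D01 := derive_fst_component0 (fun x => barV Vm x G) z.
    move: e1 e2; rewrite d10 d01.
    rewrite -[X in h11 * X]/('D_(0, 1) (fun y => barV Vm y.1 G) z) D01.
    rewrite -[X in h21 * X]/('D_(1, 0) (fun y => barV Vm y.1 G) z) D10.
    rewrite mulr0 add0r => <- <-.
    have [S1 SD] := (SC2 G MG).2.
    apply: derive_comm; last 2 first.
    - exact: (SD (1, 0) z Uz).2.
    - exact: (SD (0, 1) z Uz).2.
    have := nbhs_open_domain Uz; apply: filterS => y Uy.
    by split; apply: diff_derivable;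
      [exact: (S1 y Uy).1|exact: (S1 y Uy).1|exact: (SD _ y Uy).1
      |exact: (SD _ y Uy).1].
  have e1 := sym _ _ A1; have e2 := sym _ _ A2; have e3 := sym _ _ A3.
  have e4 := sym _ _ A4.
  (* [F1] and [F2] share the density sum and [dV], so subtracting their equations leaves [h22] times
     a nonzero number. *)
  have h220 : h22 = 0.
    apply/eqP; move: diff12; apply: contra_notT => h220.
    by apply: (mulfI h220); move: e1 e2; rewrite sum12 dV12; lra.
  rewrite h220 !mul0r !addr0 in e1 e2 e3 e4.
  (* Now [F1] and [F3] have equal right-hand sides but different density sums. *)
  have h120 : h12 = 0.
    apply/eqP; move: sum13; apply: contra_notT => h120.
    by apply: (mulfI h120); rewrite e1 e3 dV12 dV23.
  have h210 : h21 = 0.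
    apply/eqP; move: dV4; apply: contra_notT => h210.
    by apply: (mulfI h210); rewrite -e4 h120 mul0r mulr0.
  by rewrite (h2 F MF).1 h210 h220 !mul0r addr0.
(* The density hypothesis at [(0, 1)] also supplies some [F] with this functional value. Its scores
   at [(0, 1)] and [(0, 2)] are compared by the mean value theorem on the vertical segment. *)
have [F [_ [_ [_ [_ [_ [_ [_ [[[MF _ TF] _ _ _] _]]]]]]]]] := Hdens 0 1 ltr01.
have U a : 0 <= a -> open_domain ((0, 1) + a *: (0, 1) : R * R).
  by move=> a0; rewrite /open_domain/= [a *: 1]mulr1 ltr_wpDr.
have := @MVT_line R _ (fun y => fine (barS S y F)) (0, 1) (0, 1) 1 ltr01.
case=> [a /andP[a0 _]|a /andP[a0 _]].
  by apply: diff_derivable; have [] := (SC2 F MF).2.1 _ (U a a0).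
rewrite critical//; last exact/U/ltW.
rewrite mul0r => /eqP; rewrite subr_eq0 => /eqP eS.
have U1 : open_domain ((0, 1) : R * R) by exact: ltr01.
have U2 : open_domain ((0, 1) + 1 *: (0, 1) : R * R) by exact: U.
have {}TF : Tm F = (0, 1) by [].
(* Equal scores would make [(0, 2)] the functional value, contradicting the second coordinate of
   [TF]. *)
have [_] := Sconsistent _ F (ltW U2) MF.
rewrite TF -(fineK ((SC2 F MF).1 _ U2)) -(fineK ((SC2 F MF).1 _ U1)) eS.
move=> /(_ erefl) /(congr1 snd) /=.
rewrite [1 *: 1]mulr1; lra.
Qed.
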